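(* Let $k\geq 2$ and $n\geq 1$ be integers with $nk$ even, and let $G$ be a complete balanced $k$-partite graph with $n$ vertices in each part. Then $W(G)\geq \left(\frac{3}{2}k-1\right)n-1$.
   Context: All graphs are finite, undirected, without loops or multiple edges. A complete $k$-partite graph is a graph whose vertex set is partitioned into $k$ independent sets $V_1,\ldots,V_k$ such that every vertex of $V_i$ is adjacent to every vertex of $V_j$ for all $i\neq j$; it is balanced if $|V_1|=\cdots=|V_k|$. An edge-coloring of a graph $G$ with colors $1,\ldots,t$ is an interval $t$-coloring if every color $1,\ldots,t$ is used on at least one edge, and for each vertex the colors of the edges incident to it are pairwise distinct and form a set of consecutive integers. $G$ is interval colorable if it has an interval $t$-coloring for some positive integer $t$; for an interval colorable $G$, $W(G)$ denotes the greatest $t$ such that $G$ has an interval $t$-coloring. (Such $G$ with $nk$ even is interval colorable.) *)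

(* Defs.v *)
From mathcomp Require Import all_boot.
From mathcomp Require Import boolp.

Set Implicit Arguments.
Unset Strict Implicit.
Unset Printing Implicit Defensive.

Record sgraph := SGraph {
  vertex :> finType;
  adj : rel vertex;
  adj_sym : symmetric adj;
  adj_irrefl : irreflexive adj }.

Definition edges (G : sgraph) : {set {set G}} :=
  [set [set p.1; p.2] | p in [pred p : G * G | adj p.1 p.2]].

Definition incident (G : sgraph) (x : G) : {set {set G}} :=
  [set A in edges G | x \in A].

Definition complete_balanced_multipartite (G : sgraph) (k n : nat) : Prop :=
  exists V : 'I_k -> {set G},
    [/\ \bigcup_(i < k) V i = [set: G],
        forall i j, i != j -> [disjoint V i & V j],
        forall i, {in V i &, forall x y, ~~ adj x y},
        forall i j, i != j -> {in V i & V j, forall x y, adj x y}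
      & forall i, #|V i| = n].

(* A coloring is a function on all vertex sets; only its values on edges matter. *)
Definition interval_coloring (G : sgraph) (t : nat) (c : {set G} -> nat) : Prop :=
  [/\ {in edges G, forall A, 1 <= c A <= t},
      forall i, 1 <= i <= t -> exists2 A, A \in edges G & c A = i,
      forall x : G, {in incident x &, injective c}
    & forall x : G, exists m d : nat, forall i,
        (exists2 A, A \in incident x & c A = i) <-> m <= i < m + d].

Definition has_interval_coloring (G : sgraph) (t : nat) : Prop :=
  exists c, @interval_coloring G t c.

Definition interval_colorable (G : sgraph) : Prop :=
  exists2 t, 0 < t & has_interval_coloring G t.

(* An interval t-coloring uses t distinct colors, so t is at most the number of
   edges; the value is 0 when G is not interval colorable (see max_colorsP). *)
Definition max_colors (G : sgraph) : nat :=
  \max_(t < #|edges G|.+1 | `[< has_interval_coloring G t >]) t.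

Lemma has_interval_coloring_leq (G : sgraph) (t : nat) :
  has_interval_coloring G t -> t <= #|edges G|.
Proof.
case=> c [_ surj _ _].
have -> : t = size (iota 1 t) by rewrite size_iota.
rewrite cardE -(size_map c); apply: uniq_leq_size; first exact: iota_uniq.
move=> i; rewrite mem_iota add1n ltnS => /surj[A AG <-].
by apply: map_f; rewrite mem_enum.
Qed.

Lemma max_colorsP (G : sgraph) : interval_colorable G ->
  has_interval_coloring G (max_colors G) /\
  forall t, has_interval_coloring G t -> t <= max_colors G.
Proof.
case=> t0 _ ht0; split; last first.
  move=> t ht; have le := has_interval_coloring_leq ht.
  rewrite -ltnS in le.
  by apply: (@leq_bigmax_cond _ _ (@nat_of_ord _) (Ordinal le)); apply/asboolP.
have le := has_interval_coloring_leq ht0; rewrite -ltnS in le.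
rewrite /max_colors (bigop.bigmax_eq_arg (Ordinal le)); last exact/asboolP.
by case: arg_maxnP => [|i /asboolP //]; apply/asboolP.
Qed.

Lemma max_colors_gt0 (G : sgraph) : 0 < max_colors G -> interval_colorable G.
Proof.
rewrite /max_colors; apply: contraPP => nG; apply/negP; rewrite -leqNgt.
apply/bigmax_leqP => t /asboolP ht; rewrite leqn0 -[_ == _]negbK -lt0n.
by apply/negP => t0; apply: nG; exists t.
Qed.

(* Main.v *)
(* Split 2m base vertices into (i, s) with i < m and s one of two sides.  Color
   edges within a side and the edges (i, 0)(i, 1) by i + j or, when i + j >= m,
   by i + j + m - 1; the remaining cross edges form m - 1 perfect matchings,
   according to the residue of j - i mod m, which take the middle colors
   m, ..., 2m - 2.  Vertex (i, s) then sees exactly the colors i, ..., i + 2m - 2,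
   so K_2m gets 3m - 2 colors.  Deleting the e first middle matchings and shifting
   down the colors above leaves an interval coloring with 3m - 2 - e colors.
   Replacing each base vertex by q independent vertices and each edge of color c
   by K_q,q colored q c + a + b + 1 gives q (3m - 1 - e) - 1 colors.  For n odd
   (k even) take 2m = k, q = n, e = 0; for n = 2q take m = k, e = 1, the deleted
   matching making the base graph complete multipartite with parts of size 2. *)
Require Import Defs.
From mathcomp Require Import all_boot all_order all_algebra.
From mathcomp Require Import zify lra.

Import Order.TTheory GRing.Theory Num.Theory.

(* Equal to [(j - i) mod m] for [i, j < m]. *)
Definition cdiff (m i j : nat) : nat := if i <= j then j - i else m + j - i.

(** The index on side [true] minus the index on side [false], modulo [m], whichever vertex comes
    first; hence symmetric across sides. *)
Definition side_diff (m : nat) (u v : nat * bool) : nat :=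
  if u.2 then cdiff m v.1 u.1 else cdiff m u.1 v.1.

Definition base_adj (m e : nat) (u v : nat * bool) : bool :=
  if u.2 == v.2 then u.1 != v.1
  else (side_diff m u v == 0) || (e < side_diff m u v).

Definition base_color (m e : nat) (u v : nat * bool) : nat :=
  if (u.2 == v.2) || (side_diff m u v == 0) then
    if u.1 + v.1 < m then u.1 + v.1 else u.1 + v.1 + m - e.+1
  else m + side_diff m u v - e.+1.

Ltac ifs_lia := repeat (case: ifP => /=); lia.

Ltac base_lia := rewrite /base_adj /base_color /side_diff /cdiff /=; ifs_lia.

Lemma base_color_sym (m e : nat) (u v : nat * bool) :
  base_color m e u v = base_color m e v u.
Proof. by case: u v => i [] [j []]; base_lia. Qed.

Lemma base_color_bounds {m e : nat} {u v : nat * bool} :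
  e < m -> u.1 < m -> v.1 < m -> base_adj m e u v ->
  u.1 <= base_color m e u v < u.1 + (2 * m - e.+1).
Proof. by case: u v => i [] [j []]; base_lia. Qed.

(** The low, middle and high colors occupy disjoint ranges, so equal colors arise from the same
    formula, which fixes the neighbor's index. Outside the middle range its side is the opposite one
    exactly when that index is [u.1]. *)
Lemma base_color_inj {m e : nat} {u v w : nat * bool} :
  e < m -> u.1 < m -> v.1 < m -> w.1 < m ->
  base_adj m e u v -> base_adj m e u w ->
  base_color m e u v = base_color m e u w -> v = w.
Proof.
move=> em um vm wm uv uw E.
suff: v.1 = w.1 /\ v.2 = w.2 by case: v w {vm wm uv uw E} => ? ? [? ?] /= [-> ->].
move: em um vm wm uv uw E.
by case: u v w => i [] [j []] [l []]; base_lia.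
Qed.

Lemma base_color_surj {m e : nat} {u : nat * bool} {c : nat} :
  e < m -> u.1 < m -> u.1 <= c < u.1 + (2 * m - e.+1) ->
  exists v, [/\ v.1 < m, base_adj m e u v & base_color m e u v = c].
Proof.
case: u => i s /= em im ic.
have [cm|cm] := ltnP c m.
  (* The index must be [c - i]; if this is [i] itself, the neighbor is the twin on the other
     side. *)
  exists (c - i, if c - i == i then ~~ s else s).
  by case: s; case: (c - i =P i) => ?; split; base_lia.
have [cm2|cm2] := ltnP c (2 * m - e.+1); last first.
  exists (c + e.+1 - m - i, if c + e.+1 - m - i == i then ~~ s else s).
  by case: s; case: (c + e.+1 - m - i =P i) => ?; split; base_lia.
(* A middle color [c] belongs to the matching of difference [d]. *)
pose d := c + e.+1 - m.
exists (if s then if d <= i then i - d else i + m - d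
        else if i + d < m then i + d else i + d - m, ~~ s).
by rewrite /d; case: s; split; base_lia.
Qed.

Section PairColoring.

Variables (G : sgraph) (F : G -> G -> nat).
Hypothesis F_sym : forall x y : G, adj x y -> F x y = F y x.

(** The order of the ends found by [pick] is arbitrary, which [F_sym] makes harmless; 0 is a default
    off the edges. *)
Definition pair_coloring (A : {set G}) : nat :=
  if [pick p : G * G | adj p.1 p.2 && (A == [set p.1; p.2])] is Some p
  then F p.1 p.2 else 0.

Lemma pair_coloringE (x y : G) : adj x y -> pair_coloring [set x; y] = F x y.
Proof.
move=> xy; rewrite /pair_coloring; case: pickP => [[u v] /= /andP[uv /eqP E]|].
  have : u \in [set x; y] by rewrite E set21.
  have : v \in [set x; y] by rewrite E set22.
  by move=> /set2P[] vE /set2P[] uE; move: uv; rewrite uE vE ?adj_irrefl // => /F_sym.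
by move/(_ (x, y)); rewrite /= xy eqxx.
Qed.

Lemma edgesP {A : {set G}} :
  reflect (exists x y : G, adj x y /\ A = [set x; y]) (A \in edges G).
Proof.
apply: (iffP imsetP) => [[[x y] /= xy ->]|[x [y [xy ->]]]]; first by exists x, y.
by exists (x, y).
Qed.

Lemma incidentP {x : G} {A : {set G}} :
  reflect (exists2 y : G, adj x y & A = [set x; y]) (A \in incident x).
Proof.
rewrite inE; apply: (iffP andP) => [[/edgesP[u [v [uv ->]]] /set2P[->|->]]|].
- by exists v.
- by exists u; rewrite 1?adj_sym // setUC.
- by case=> y xy ->; rewrite set21; split=> //; apply/edgesP; exists x, y.
Qed.

Lemma pair_coloring_interval (t : nat) :
    (forall x y : G, adj x y -> 1 <= F x y <= t) ->
    (forall i, 1 <= i <= t -> exists x y : G, adj x y /\ F x y = i) ->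
    (forall x y z : G, adj x y -> adj x z -> F x y = F x z -> y = z) ->
    (forall x : G, exists m d, forall i,
       (exists2 y : G, adj x y & F x y = i) <-> m <= i < m + d) ->
  interval_coloring t pair_coloring.
Proof.
move=> bound surj inj interval; split.
- by move=> A /edgesP[x [y [xy ->]]]; rewrite pair_coloringE ?bound.
- move=> i /surj[x [y [xy <-]]]; exists [set x; y]; last exact: pair_coloringE.
  by apply/edgesP; exists x, y.
- move=> x A B /incidentP[y xy ->] /incidentP[z xz ->].
  by rewrite !pair_coloringE // => /(inj _ _ _ xy xz) ->.
move=> x; have [m [d H]] := interval x; exists m, d => i; rewrite -H; split.
  by case=> A /incidentP[y xy ->]; rewrite pair_coloringE //; exists y.
case=> y xy <-; exists [set x; y]; last exact: pair_coloringE.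
by apply/incidentP; exists y.
Qed.

End PairColoring.

Lemma blowup_has_interval_coloring (G : sgraph) (m e q : nat)
    (u : G -> nat * bool) (a : G -> nat) :
    e < m -> (forall x, (u x).1 < m) -> (forall x, a x < q) ->
    (forall i s b, i < m -> b < q -> exists x, u x = (i, s) /\ a x = b) ->
    (forall x y, u x = u y -> a x = a y -> x = y) ->
    (forall x y : G, adj x y = base_adj m e (u x) (u y)) ->
  has_interval_coloring G (q * (3 * m - e.+1) - 1).
Proof.
move=> em um aq lab_surj lab_inj adjE.
pose F (x y : G) := (q * base_color m e (u x) (u y) + a x + a y).+1.
have F_interval (x : G) i : (exists2 y : G, adj x y & F x y = i) <->
    (q * (u x).1 + a x).+1 <= i < (q * (u x).1 + a x).+1 + q * (2 * m - e.+1).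
  split=> [[y xy <-]|].
    move: xy; rewrite adjE => /(base_color_bounds em (um x) (um y)).
    have := aq x; have := aq y; rewrite /F.
    by set c := base_color _ _ _ _; move: (2 * m - e.+1) => w; nia.
  (* Inverting [F]: division of [j] by [q] gives the base color as quotient and the neighbor's label
     as remainder. *)
  move=> iP; pose j := i.-1 - a x.
  have q0 : 0 < q by have := aq x; lia.
  have jE := divn_eq j q; have jq := ltn_pmod j q0.
  have : (u x).1 <= j %/ q < (u x).1 + (2 * m - e.+1).
    by rewrite leq_divRL // ltn_divLR // /j; lia.
  case/(base_color_surj em (um x)) => v [vm uv cE].
  have [y [uy ay]] := lab_surj v.1 v.2 (j %% q) vm jq.
  have {}uy : u y = v by rewrite uy; case: (v).
  exists y; first by rewrite adjE uy.
  by rewrite /F uy cE ay; rewrite /j in jE *; lia.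
exists (pair_coloring _ F); apply: pair_coloring_interval.
- by move=> x y _; rewrite /F base_color_sym -!addnA [a x + _]addnC.
- move=> x y xy; have /F_interval : exists2 z : G, adj x z & F x z = F x y.
    by exists y.
  by have := um x; have := aq x; move: em; nia.
- move=> i iP; have q0 : 0 < q by lia.
  suff [x /F_interval[y xy <-]] : exists x, (q * (u x).1 + a x).+1 <= i
      < (q * (u x).1 + a x).+1 + q * (2 * m - e.+1) by exists x, y.
  (* Each color up to [q * m] is the least one at some vertex; the vertex with both labels maximal
     starts at [q * m] and sees all later colors. *)
  have [im|im] := leqP i (q * m).
    have [||x [ux ax]] := lab_surj (i.-1 %/ q) true (i.-1 %% q).
    - by rewrite ltn_divLR //; lia.
    - exact: ltn_pmod.
    exists x; rewrite ux ax /= mulnC -divn_eq.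
    by move: em iP; nia.
  have [||x [ux ax]] := lab_surj m.-1 true q.-1; try lia.
  by exists x; rewrite ux ax /=; move: em iP im; nia.
- move=> x y z xy xz; rewrite /F => E.
  have {}E : q * base_color m e (u x) (u y) + a y
           = q * base_color m e (u x) (u z) + a z by lia.
  have q0 : 0 < q by have := aq x; lia.
  have ayz : a y = a z.
    by have := congr1 (modn^~ q) E; rewrite /= ![q * _]mulnC !modnMDl !modn_small.
  apply: lab_inj => //; apply: (base_color_inj (m := m) (e := e) (u := u x)) => //.
  + by rewrite -adjE.
  + by rewrite -adjE.
  by apply/eqP; rewrite -(eqn_pmul2l q0); apply/eqP; lia.
move=> x; exists (q * (u x).1 + a x).+1, (q * (2 * m - e.+1)) => i.
exact: F_interval.
Qed.

(** Coordinates for the blow-up: [p] is the part, [r] the rank in an enumeration of it. *)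
Lemma complete_balanced_multipartite_labels {G : sgraph} {k n : nat} :
    0 < n -> complete_balanced_multipartite G k n ->
  exists p r : G -> nat,
    [/\ forall x, p x < k,
        forall x, r x < n,
        forall i b, i < k -> b < n -> exists x, p x = i /\ r x = b,
        forall x y, p x = p y -> r x = r y -> x = y
      & forall x y : G, adj x y = (p x != p y)].
Proof.
move=> n0 [V [cov dis ind adjV card]].
have partP (x : G) : exists i, x \in V i.
  by have : x \in [set: G] by []; rewrite -cov => /bigcupP[i _]; exists i.
pose p x : 'I_k := xchoose (partP x).
have pV x : x \in V (p x) := xchooseP (partP x).
have Vp x i : x \in V i -> p x = i.
  move=> xi; apply/eqP; apply: contraT => /dis/disjointFr/(_ (pV x)).
  by rewrite xi.
exists (fun x => nat_of_ord (p x)), (fun x => index x (enum (V (p x)))); split=> //.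
- by move=> x; rewrite -(card (p x)) cardE index_mem mem_enum.
- move=> i b ik bn; pose j := Ordinal ik.
  have /card_gt0P[x0 _] : 0 < #|V j| by rewrite card.
  have bs : b < size (enum (V j)) by rewrite -cardE card.
  exists (nth x0 (enum (V j)) b).
  have /Vp-> : nth x0 (enum (V j)) b \in V j by rewrite -mem_enum mem_nth.
  by rewrite index_uniq ?enum_uniq.
- move=> x y /val_inj pxy; rewrite pxy.
  by move=> /(congr1 (nth x (enum (V (p y))))); rewrite !nth_index ?mem_enum // -pxy.
move=> x y; case: (eqVneq (p x) (p y)) => [pxy|pxy].
  by rewrite pxy eqxx; apply/negbTE/(ind (p y)); rewrite // -pxy.
by rewrite (adjV _ _ pxy).
Qed.

Lemma complete_balanced_multipartite_coloring {G : sgraph} {k n t : nat} :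
    2 <= k -> 1 <= n -> ~~ odd (n * k) ->
    complete_balanced_multipartite G k n -> 2 * t.+1 = (3 * k - 2) * n ->
  has_interval_coloring G t.
Proof.
move=> k2 n1 nk /(complete_balanced_multipartite_labels n1).
case=> p [r [pk rn surj inj adjE]] tE.
have [n_odd|n_even] := boolP (odd n).
  have [m kE] : exists m, k = 2 * m.
    by exists k./2; move: nk; rewrite oddM n_odd /=; lia.
  have -> : t = n * (3 * m - 1) - 1 by move: tE; rewrite kE; nia.
  (* With [e = 0] the base graph is complete on [2 * m] vertices, one for each part. *)
  apply: (@blowup_has_interval_coloring _ m 0 n
    (fun x => (if p x < m then p x else p x - m, p x < m)) r) => //.
  - by lia.
  - by move=> x /=; have := pk x; ifs_lia.
  - move=> i s b im bn; have [||x [px rx]] := surj (if s then i else i + m) b => //.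
      by case: s; lia.
    by exists x; rewrite px; split=> //; case: s {px}; congr pair; ifs_lia.
  - by move=> x y [] pxy pxy' /(inj x y); apply; move: pxy pxy'; have := pk x; ifs_lia.
  move=> x y; rewrite adjE.
  by have := pk x; have := pk y; base_lia.
have [q nE] : exists q, n = 2 * q by exists n./2; move: n_even; lia.
have -> : t = q * (3 * k - 2) - 1 by move: tE; rewrite nE; nia.
(* The two halves of each part lie on opposite sides, one index apart, so that
   the removed matching [side_diff = 1] falls inside the parts. *)
apply: (@blowup_has_interval_coloring _ k 1 q
  (fun x => (if r x < q then p x else if (p x).+1 == k then 0 else (p x).+1,
             q <= r x))
  (fun x => if r x < q then r x else r x - q)) => //.
- by move=> x /=; have := pk x; ifs_lia.
- by move=> x /=; have := rn x; ifs_lia.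
- move=> i s b im bn.
  have [||x [px rx]] := surj (if s then if i == 0 then k.-1 else i.-1 else i)
    (if s then b + q else b).
  + by case: s; ifs_lia.
  + by case: s; ifs_lia.
  by exists x; rewrite px rx; split; [case: s {px rx}; congr pair|case: s {px rx}]; ifs_lia.
- move=> x y [] pxy sxy rxy.
  by apply: inj; move: pxy sxy rxy; have := pk x; have := pk y; base_lia.
move=> x y; rewrite adjE.
by have := pk x; have := pk y; base_lia.
Qed.

Local Open Scope ring_scope.

Theorem theorem7 (G : sgraph) (k n : nat)
    (hk : (2 <= k)%N) (hn : (1 <= n)%N) (hnk : ~~ odd (n * k)%N)
    (hG : complete_balanced_multipartite G k n) :
  (3%:R / 2%:R * k%:R - 1) * n%:R - 1 <= (max_colors G)%:R :> rat.
Proof.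
(* As [n * k] is even, so is [(3 * k - 2) * n]; this [t] equals the claimed bound. *)
have [t tE] : exists t, (2 * t.+1 = (3 * k - 2) * n)%N.
  by exists ((3 * k - 2) * n)./2.-1; move: hnk; nia.
have ht := complete_balanced_multipartite_coloring hk hn hnk hG tE.
have t0 : (0 < t)%N by nia.
have [_ /(_ t ht)] : has_interval_coloring G (max_colors G) /\
    forall t, has_interval_coloring G t -> (t <= max_colors G)%N.
  by apply: max_colorsP; exists t.
rewrite -(ler_nat rat); apply: le_trans.
have : 2 * (t%:R + 1) = (3 * k%:R - 2) * n%:R :> rat.
  by rewrite natr1 -!(natrM _ 2) tE natrM natrB ?natrM; [|lia].
lra.
Qed.
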